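(* $\mathrm{non}({\sf Split}(\Omega,\Omega))=\mathfrak{u}$; that is, the minimum cardinality of a set of real numbers which fails to have property ${\sf Split}(\Omega,\Omega)$ equals $\mathfrak{u}$.
   Context: ''Cover'' means countable open cover. For a set $X$ of reals, a cover $\mathcal{U}$ of $X$ is an $\omega$-cover if $X\notin\mathcal{U}$ and every finite subset of $X$ is contained in some member of $\mathcal{U}$. $X$ has ${\sf Split}(\Omega,\Omega)$ if every $\omega$-cover $\mathcal{U}$ of $X$ can be partitioned into two subfamilies each of which is an $\omega$-cover of $X$. $\mathfrak{u}$ is the minimal cardinality of a base for a nonprincipal ultrafilter on $\omega$. *)

(* Defs.v *)
From mathcomp Require Import all_boot all_order all_algebra.
From mathcomp Require Import all_classical all_reals all_analysis.

Set Implicit Arguments.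
Unset Strict Implicit.
Unset Printing Implicit Defensive.

Import numFieldNormedType.Exports.
Local Open Scope classical_set_scope.
Local Open Scope card_scope.

(* Covers are families of relatively open subsets of X (so that the condition
   [~ U X] below means that X is not a member of the cover), indexed by
   themselves. *)
Definition countable_open_cover (R : realType) (X : set R)
    (U : set (set R)) : Prop :=
  [/\ countable U, open_fam_of X U id & cover U id = X].

Definition omega_cover (R : realType) (X : set R) (U : set (set R)) : Prop :=
  [/\ countable_open_cover X U,
      ~ U X
    & forall F : set R, finite_set F -> F `<=` X -> exists2 A, U A & F `<=` A].

Definition Split_Omega_Omega (R : realType) (X : set R) : Prop :=
  forall U : set (set R), omega_cover X U ->
    exists V W : set (set R),
      [/\ V `|` W = U, V `&` W = set0, omega_cover X V & omega_cover X W].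

Definition nonprincipal (T : Type) (F : set_system T) : Prop :=
  forall x : T, F <> principal_filter x.

(* [F = filter_from B id] says that F consists of the supersets of members
   of B, i.e. that B is contained in F and generates it. *)
Definition nonprincipal_ultrafilter_base (B : set (set nat)) : Prop :=
  exists F : set_system nat,
    [/\ UltraFilter F, nonprincipal F & F = filter_from B id].

(* A is a witness of the cardinal min {|B| : P B}; two such cardinals are equal
   iff they have equipotent witnesses. *)
Definition has_min_card (T : Type) (P : set T -> Prop) (A : set T) : Prop :=
  P A /\ forall B : set T, P B -> A #<= B.

(* Main.v *)
(* If an omega-cover U of X cannot be split, the sets S_F of members of U that
   contain a given finite subset F of X form a base of a nonprincipal ultrafilter:
   a set D such that D and its complement both fail to contain any S_F would split
   U. There are |X| many sets S_F, as X is infinite. Conversely, a base B of a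
   nonprincipal ultrafilter is a subset of the Cantor space, hence may be seen as
   a set of reals, and the traces on B of the clopen sets {b | n in b} form an
   omega-cover; one of the two parts of a splitting is indexed by a set in the
   ultrafilter, which contains some b in B, and the other part misses {b}. *)
Require Import Defs.
From mathcomp Require Import all_boot all_order all_algebra.
From mathcomp Require Import all_classical all_reals all_analysis.
From mathcomp Require Import lra.

Set Implicit Arguments.
Unset Strict Implicit.
Unset Printing Implicit Defensive.

Import Order.TTheory GRing.Theory Num.Theory.
Import numFieldNormedType.Exports.

Local Open Scope classical_set_scope.
Local Open Scope card_scope.

(** * Cardinal comparison and arithmetic via Zorn's lemma *)

Lemma card_le_inj T U (A : set T) (B : set U) (f : T -> U) :
  set_fun A B f -> set_inj A f -> A #<= B.
Proof.
move=> fAB fI.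
have /injfunPex[g] : exists2 g : T -> U, set_fun A B g & set_inj A g by exists f.
exact: inj_card_le.
Qed.

Lemma card_le_injP T (U : pointedType) (A : set T) (B : set U) : A #<= B ->
  exists2 f : T -> U, set_fun A B f & set_inj A f.
Proof. by move=> /pcard_leP[g]; apply/injfunPex; squash g. Qed.

Lemma card_le_setX (T T' U U' : pointedType) (A : set T) (A' : set T')
    (B : set U) (B' : set U') :
  A #<= B -> A' #<= B' -> A `*` A' #<= B `*` B'.
Proof.
move=> /card_le_injP[f fAB fI] /card_le_injP[f' fAB' fI'].
apply: (@card_le_inj _ _ _ _ (fun p => (f p.1, f' p.2))).
  by move=> [a a'] [/= /fAB ? /fAB' ?].
move=> [a a'] [b b'] /set_mem[/= Aa Aa'] /set_mem[/= Ab Ab'] [ab ab'].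
by congr pair; [apply: fI|apply: fI'] => //; exact/mem_set.
Qed.

(* Zorn is applied to sets D of choice functions on P whose evaluations are all
   injective on D: a maximal such D has an evaluation that is onto its target. *)
Lemma min_card_exists (T : pointedType) (P : set (set T)) : P !=set0 ->
  exists A, has_min_card P A.
Proof.
move=> [A0 PA0].
pose Q (D : set (set T -> T)) :=
  (forall d B, D d -> P B -> B (d B)) /\
  (forall d d' B, D d -> D d' -> P B -> d B = d' B -> d = d').
have [|D [[DP Dinj] Dmax]] := @Zorn_bigcup _ Q.
  move=> F FQ Ftot; split=> [d B [D FD Dd] PB|d d' B [D FD Dd] [D' FD' Dd'] PB].
    exact: ((FQ _ FD).1 _ _ Dd PB).
  have [DD'|D'D] := Ftot _ _ FD FD'.
    by apply: (FQ _ FD').2 => //; exact: DD'.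
  by apply: (FQ _ FD).2 => //; exact: D'D.
have [[B PB DB]|noB] := pselect (exists2 B, P B & B `<=` [set d B | d in D]).
  exists B; split=> // C PC.
  (* [B] is covered by an image of [D], and evaluation at [C] embeds [D] into [C]. *)
  apply: (card_le_trans (subset_card_le DB)).
  apply: (card_le_trans (card_image_le _ _)).
  apply: (@card_le_inj _ _ _ _ (fun d => d C)); first by move=> d Dd; exact: (DP _ _ Dd PC).
  by move=> d d' /set_mem Dd /set_mem Dd'; exact: Dinj.
(* Otherwise each [B] in [P] has a point missed by all [d B]; choosing such points yields [c], which
   extends [D] properly. *)
have /choice[c cP] : forall B, exists x, P B -> B x /\ forall d, D d -> d B <> x.
  move=> B; have [PB|nPB] := pselect (P B); last by exists point.
  have /existsNP[x /not_implyP[Bx nx]] : ~ (B `<=` [set d B | d in D]).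
    by move=> BD; apply: noB; exists B.
  by exists x => _; split=> // d Dd dx; apply: nx; exists d.
exfalso; apply: (Dmax (D `|` [set c])).
  split; first by left.
  by move=> /(_ c (or_intror erefl)) Dc; have [_ /(_ _ Dc)] := cP _ PA0.
split=> [d B [Dd|->] PB|d d' B [Dd|->] [Dd'|->] PB dd'].
- exact: (DP _ _ Dd PB).
- exact: (cP _ PB).1.
- exact: Dinj dd'.
- by have /(_ _ Dd)[] := (cP _ PB).2.
- by have /(_ _ Dd')[] := (cP _ PB).2.
- by [].
Qed.

(** The class consisting of [A] and [B] alone has a member of least cardinality. *)
Lemma card_le_total (T : pointedType) (A B : set T) : A #<= B \/ B #<= A.
Proof.
have [|C [PC Cmin]] := @min_card_exists T [set A; B]; first by exists A; left.
by case: PC Cmin => -> Cmin; [left|right]; apply: Cmin; [right|left].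
Qed.

(** The union is embedded into pairs from [Y]: the first coordinate, one of the distinct points
    [h 0] and [h 1], tags the points inside and outside [A]. *)
Lemma card_le_setU (T : pointedType) (A B Y : set T) : infinite_set Y ->
  Y `*` Y #<= Y -> A #<= Y -> B #<= Y -> A `|` B #<= Y.
Proof.
move=> Yinf YY /card_le_injP[f fY fI] /card_le_injP[g gY gI].
have [h hY hI] : exists2 h : nat -> T, set_fun setT Y h & set_inj setT h.
  by apply: card_le_injP; apply/infiniteP.
apply: card_le_trans YY.
have memT (n : nat) : n \in [set: nat] by exact/mem_set.
apply: (@card_le_inj _ _ _ _ (fun x => if x \in A then (h 0, f x) else (h 1, g x))).
  move=> x ABx; case: ifPn => [/set_mem Ax|/negP nAx].
    by split; [exact: hY|exact: fY].
  split; first exact: hY.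
  by apply: gY; case: ABx => // /mem_set.
move=> x y /set_mem ABx /set_mem ABy.
case: ifPn => [Ax|/negP nAx]; case: ifPn => [Ay|/negP nAy].
- by move=> [/fI]; apply.
- by move=> [/(hI _ _ (memT _) (memT _))].
- by move=> [/(hI _ _ (memT _) (memT _))].
- move=> [/gI]; apply; apply/mem_set.
    by case: ABx => // /mem_set.
  by case: ABy => // /mem_set.
Qed.

(* Zorn is applied to the graphs G of injections Y `*` Y -> Y with Y `<=` X,
   where Y is recovered from G as the set of first coordinates. *)
Lemma card_setX_infinite (T : pointedType) (X : set T) : infinite_set X ->
  X `*` X #<= X.
Proof.
move=> Xinf.
pose dom (G : set (T * T * T)) := [set a | exists b c, G (a, b, c)].
pose Q (G : set (T * T * T)) :=
  [/\ dom G `<=` X,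
      forall a b c, G (a, b, c) -> dom G b /\ dom G c,
      forall a b, dom G a -> dom G b -> exists c, G (a, b, c),
      forall a b c c', G (a, b, c) -> G (a, b, c') -> c = c' &
      forall a b a' b' c, G (a, b, c) -> G (a', b', c) -> (a, b) = (a', b')].
have [|G [[GX Gd Gt Gf Gi] Gmax]] := @Zorn_bigcup _ Q.
  move=> F FQ Ftot.
  have both G H x y : F G -> F H -> G x -> H y -> exists K, [/\ F K, K x & K y].
    move=> FG FH Gx Hy; have [GH|HG] := Ftot _ _ FG FH.
      by exists H; split=> //; exact: GH.
    by exists G; split=> //; exact: HG.
  split.
  - move=> a [b [c [G FG Gabc]]]; have [GX _ _ _ _] := FQ _ FG.
    by apply: GX; exists b, c.
  - move=> a b c [G FG Gabc]; have [_ /(_ _ _ _ Gabc) Gd _ _ _] := FQ _ FG.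
    by case: Gd => -[p [q Gp]] [r [s Gr]]; split; [exists p, q|exists r, s]; exists G.
  - move=> a b [b1 [c1 [G FG Ga]]] [b2 [c2 [H FH Hb]]].
    have [K [FK Ka Kb]] := both _ _ _ _ FG FH Ga Hb.
    have [_ _ Kt _ _] := FQ _ FK.
    have [|| c Kc] := Kt a b; [by exists b1, c1|by exists b2, c2|].
    by exists c, K.
  - move=> a b c c' [G FG Ga] [H FH Hb].
    have [K [FK Ka Kb]] := both _ _ _ _ FG FH Ga Hb.
    by have [_ _ _ Kf _] := FQ _ FK; exact: Kf Ka Kb.
  - move=> a b a' b' c [G FG Ga] [H FH Hb].
    have [K [FK Ka Kb]] := both _ _ _ _ FG FH Ga Hb.
    by have [_ _ _ _ Ki] := FQ _ FK; exact: Ki Ka Kb.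
set Y := dom G in GX Gd Gt.
have YY : Y `*` Y #<= Y.
  have /choice[f fG] : forall p : T * T, exists c, (Y `*` Y) p -> G (p, c).
    move=> [a b]; have [[/= Ya Yb]|nY] := pselect ((Y `*` Y) (a, b)).
      by have [c Gc] := Gt _ _ Ya Yb; exists c.
    by exists point.
  apply: (@card_le_inj _ _ _ _ f).
    by move=> [a b] /fG /Gd[].
  move=> [a b] [a' b'] /set_mem /fG + /set_mem /fG + /= ff'.
  by rewrite -ff'; exact: Gi.
(* New pairs can be sent into [Z] without clashing with the old values, which lie in [Y]; the
   enlarged graph contradicts maximality. *)
have ext Z : Z `<=` X -> (forall z, Z z -> ~ Y z) -> infinite_set Z ->
    (Y `|` Z) `*` (Y `|` Z) #<= Z -> False.
  move=> ZX ZY /infinite_setN0[z0 Zz0] /card_le_injP[g gZ gI].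
  pose W := Y `|` Z.
  pose H := G `|` [set p | (W `*` W) p.1 /\ ~ (Y `*` Y) p.1 /\ p.2 = g p.1].
  have domH : dom H = W.
    apply/seteqP; split=> [a [b [c [Gabc|[/= [Wa _] _]]]]|a Wa] //.
      by left; exists b, c.
    exists z0, (g (a, z0)); right; split; first by split=> //; right.
    by split=> // -[_ /(ZY _ Zz0)].
  apply: (Gmax H).
    split; first by left.
    move=> /(_ (z0, z0, g (z0, z0))).
    have HH : H (z0, z0, g (z0, z0)).
      right; split; first by split; right.
      by split=> // -[/(ZY _ Zz0)].
    by move=> /(_ HH) Gz; case: (ZY _ Zz0); exists z0, (g (z0, z0)).
  have GYY a b c : G (a, b, c) -> (Y `*` Y) (a, b).
    by move=> Gabc; split; [exists b, c|have [] := Gd _ _ _ Gabc].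
  split.
  - by rewrite domH => a [/GX//|/ZX].
  - rewrite domH => a b c [/Gd[Yb Yc]|/= [Wab [_ ->]]]; first by split; left.
    by split; [case: Wab|right; exact: gZ].
  - rewrite domH => a b Wa Wb.
    have [[Ya Yb]|nY] := pselect ((Y `*` Y) (a, b)).
      by have [c Gc] := Gt _ _ Ya Yb; exists c; left.
    by exists (g (a, b)); right.
  - move=> a b c c' [Gabc|[/= Wab [nY ->]]] [Gabc'|[/= Wab' [nY' ->]]] //.
    + exact: Gf Gabc Gabc'.
    + by have := GYY _ _ _ Gabc.
    + by have := GYY _ _ _ Gabc'.
  - move=> a b a' b' c [Gabc|[/= Wab [nY cE]]] [Gabc'|[/= Wab' [nY' cE']]] //.
    + exact: Gi Gabc Gabc'.
    + by have [_ Yc] := Gd _ _ _ Gabc; case: (ZY c) => //; rewrite cE'; exact: gZ.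
    + by have [_ Yc] := Gd _ _ _ Gabc'; case: (ZY c) => //; rewrite cE; exact: gZ.
    + by apply: gI; rewrite ?inE -?cE.
have extc Z : Z `<=` X `\` Y -> infinite_set Z -> Y #<= Z -> Z `*` Z #<= Z -> False.
  move=> ZXY Zinf YZ ZZ; apply: (ext Z) => //.
  - by move=> z /ZXY[].
  - by move=> z /ZXY[].
  - have WZ : Y `|` Z #<= Z by exact: card_le_setU.
    exact: card_le_trans (card_le_setX WZ WZ) ZZ.
(* If [Y] is finite, a countably infinite subset of the rest of [X] serves as [Z]. *)
have [Yfin|Yinf] := pselect (finite_set Y).
  have : infinite_set (X `\` Y) by exact: infinite_setD.
  move=> /infiniteP /card_le_injP[h hXY hI].
  have hN : h @` setT #= [set: nat] by exact: inj_card_eq.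
  have [hN' Nh] := (card_eqPle _ _).1 hN.
  exfalso; apply: (extc (h @` setT)).
  - by move=> _ [n _ <-]; exact: hXY.
  - exact/infiniteP.
  - exact: card_le_trans (finite_set_countable Yfin) Nh.
  - apply: (card_le_trans (card_le_setX hN' hN')).
    by rewrite setXTT; apply: card_le_trans Nh; by have [] := (card_eqPle _ _).1 card_nat2.
(* If the rest of [X] is no larger than [Y], then [X] embeds into [Y] and inherits its pairing;
   otherwise a copy of [Y] outside [Y] serves as [Z]. *)
have [YXY|XYY] := card_le_total Y (X `\` Y); last first.
  have XY : X #<= Y.
    rewrite -(setDUK GX) setUC; exact: card_le_setU.
  apply: (card_le_trans (card_le_setX XY XY)).
  exact: card_le_trans YY (subset_card_le GX).
exfalso; have [f fXY fI] := card_le_injP YXY.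
have fYE : f @` Y #= Y by exact: inj_card_eq.
have [fY Yf] := (card_eqPle _ _).1 fYE.
apply: (extc (f @` Y)) => //.
- by move=> _ [y Yy <-]; exact: fXY.
- by move=> /(card_le_finite Yf).
- by apply: (card_le_trans (card_le_setX fY fY)); exact: card_le_trans YY Yf.
Qed.

Lemma card_seq_infinite (T : pointedType) (X : set T) : infinite_set X ->
  [set s : seq T | forall x, x \in s -> X x] #<= X.
Proof.
move=> Xinf; have XX := card_setX_infinite Xinf.
have [p pX pI] := card_le_injP XX.
have [x0 Xx0] := infinite_setN0 Xinf.
have NX : [set: nat] #<= X by exact/infiniteP.
apply: card_le_trans XX; apply: card_le_trans (card_le_setX NX (card_lexx X)).
(* The code of the empty list, [x0], may also be the code of a longer list; pairing the code with
   the length restores injectivity. *)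
pose code := foldr (fun x y => p (x, y)) x0.
have codeX s : (forall x, x \in s -> X x) -> X (code s).
  elim: s => //= a s IH sX; apply: pX; split=> /=.
    by apply: sX; rewrite mem_head.
  by apply: IH => x xs; apply: sX; rewrite inE xs orbT.
apply: (@card_le_inj _ _ _ _ (fun s => (size s, code s))).
  by move=> s sX; split=> //; exact: codeX.
move=> s t /set_mem + /set_mem; elim: s t => [|a s IH] [|b t] //= sX tX [st e].
have sX' x : x \in s -> X x by move=> xs; apply: sX; rewrite inE xs orbT.
have tX' x : x \in t -> X x by move=> xt; apply: tX; rewrite inE xt orbT.
have [-> cst] : (a, code s) = (b, code t).
  apply: pI => //; apply/mem_set; split=> /=; try exact: codeX.
    by apply: sX; rewrite mem_head.
  by apply: tX; rewrite mem_head.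
by congr cons; apply: IH => //; rewrite st cst.
Qed.

(** * Ultrafilters: dichotomy and existence *)

Lemma ultrafilterP T (F : set_system T) : ProperFilter F ->
  UltraFilter F <-> forall A, F A \/ F (~` A).
Proof.
move=> PF; split=> [UF A|FC]; first exact: in_ultra_setVsetC.
split=> // G PG FG; apply/seteqP; split=> // A GA.
have [//|FnA] := FC A.
have : G (A `&` ~` A) by apply: filterI => //; exact: FG.
by rewrite setICr => /filter_not_empty.
Qed.

(** An ultrafilter extending the cofinite filter is a base of itself. This makes the minimum
    defining the cardinal one over a nonempty class. *)
Lemma exists_nonprincipal_ultrafilter_base :
  exists B, nonprincipal_ultrafilter_base B.
Proof.
have [F [UF ooF]] := @ultraFilterLemma nat \oo eventually_filter.
exists F, F; split=> //.
  move=> n Fn; have : F [set m | (n < m)%N] by apply: ooF; exists n.+1.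
  by rewrite Fn => /principal_filterP /=; rewrite ltnn.
apply/seteqP; split=> [A FA|A [C FC CA]]; first by exists A.
exact: filterS CA FC.
Qed.

(** * From an unsplittable omega-cover to an ultrafilter base *)

Section omega_covers.
Variable R : realType.
Implicit Types (X : set R) (U V : set (set R)).

(** A finite [X] would be contained in, hence equal to, a member of the cover. *)
Lemma omega_cover_infinite X U : omega_cover X U -> infinite_set X.
Proof.
move=> [[_ [g _ UXg] _] nUX Ufin] Xfin.
have [A UA XA] := Ufin X Xfin (@subset_refl _ _).
apply: nUX; suff -> : X = A by [].
by apply/seteqP; split=> //; rewrite (UXg A UA) => x [].
Qed.

Lemma omega_cover_sub X U V : omega_cover X U -> V `<=` U ->
  (forall F, finite_set F -> F `<=` X -> exists2 A, V A & F `<=` A) ->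
  omega_cover X V.
Proof.
move=> [[cU [g gop UXg] covU] nUX _] VU Vfin; split=> //; last first.
  by move=> /VU.
split.
- exact: card_le_trans (subset_card_le VU) cU.
- by exists g => A /VU; [exact: gop|exact: UXg].
- apply/seteqP; split=> [x [A VA Ax]|x Xx].
    by rewrite -covU; exists A => //; exact: VU.
  have [|A VA xA] := Vfin [set x] (finite_set1 x); first by move=> _ ->.
  by exists A => //; exact: xA.
Qed.

Lemma ultrafilter_base_of_not_split X : ~ Split_Omega_Omega X ->
  exists2 B, nonprincipal_ultrafilter_base B & B #<= X.
Proof.
move=> /existsNP[U /not_implyP[oU nsplit]].
have Xinf := omega_cover_infinite oU.
have [[cU [g _ UXg] _] nUX Ufin] := oU.
(* [e] numbers the members of [U], so that subfamilies become sets of naturals. Finite subsets of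
   [X] are given as lists, whose number [card_seq_infinite] bounds. *)
have [e _ eI] := card_le_injP cU.
pose S (s : seq R) := e @` [set A | U A /\ forall x, x \in s -> A x].
pose B := S @` [set s | forall x, x \in s -> X x].
exists B; last exact: card_le_trans (card_image_le _ _) (card_seq_infinite Xinf).
have PF : ProperFilter (filter_from B id).
  apply: filter_from_proper; first apply: filter_from_filter.
  - by exists (S [::]); exists [::].
  - move=> _ _ [s sX <-] [t tX <-]; exists (S (s ++ t)).
      exists (s ++ t) => // x; rewrite mem_cat => /orP[]; [exact: sX|exact: tX].
    by move=> _ [A [UA Ast] <-]; split; exists A => //; split=> // x xs;
      apply: Ast; rewrite mem_cat xs ?orbT.
  - move=> _ [s sX <-]; have [A UA sA] := Ufin [set` s] (finite_seq s) sX.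
    by exists (e A), A.
have FS s : (forall x, x \in s -> X x) -> filter_from B id (S s).
  by move=> sX; exists (S s) => //; exists s.
exists (filter_from B id); split=> //.
  apply/ultrafilterP => D; apply: contrapT => /not_orP[nD nDC].
  apply: nsplit; exists (U `&` (e @^-1` D)), (U `&` (e @^-1` (~` D))).
  (* For each list [s] in [X], [S s] is not inside the complement of [C], so a member containing [s]
     has its number in [C]. *)
  have key C : ~ filter_from B id (~` C) -> omega_cover X (U `&` (e @^-1` C)).
    move=> nC; apply: (omega_cover_sub oU); first exact: subIsetl.
    move=> F /finite_seqP[s ->] sX; apply: contrapT => nA.
    apply: nC; exists (S s); first by exists s.
    by move=> _ [A [UA sA] <-] CA; apply: nA; exists A.
  split.
  - by rewrite -setIUr preimage_setC setUv setIT.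
  - by rewrite setIACA preimage_setC setICr setI0.
  - exact: key.
  - by apply: key; rewrite setCK.
(* If the filter were principal at [n], then [n] would number a member [A]. Some [x] in [X] is
   outside [A], yet [S [:: x]] is in the filter and so contains [n], forcing [x] into [A]. *)
move=> n Fn; have : filter_from B id [set n] by rewrite Fn; exact/principal_filterP.
move=> [_ [s sX <-] Sn].
have [A UA sA] := Ufin [set` s] (finite_seq s) sX.
have eA : e A = n by apply: Sn; exists A.
have [x Xx nAx] : exists2 x, X x & ~ A x.
  apply: contrapT => nx; apply: nUX; suff -> : X = A by [].
  apply/seteqP; split=> [x Xx|]; last by rewrite (UXg A UA) => x [].
  by apply: contrapT => nAx; apply: nx; exists x.
have : filter_from B id (S [:: x]).
  by apply: FS => y; rewrite inE => /eqP ->.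
rewrite Fn => /principal_filterP[A' [UA' xA'] eA'].
apply: nAx; suff <- : A' = A by apply: xA'; rewrite inE.
by apply: eI; [exact/mem_set|exact/mem_set|rewrite eA eA'].
Qed.

End omega_covers.

(** * Embedding the Cantor space into the reals *)

Section ternary.
Local Open Scope ring_scope.
Variable R : realType.
Implicit Types b c : set nat.

(* Base-3 expansions with digits 0 and 1: the tail after digit m is worth at most
   3^-m / 2, so two expansions first differing at m are at distance >= 3^-m / 2. *)
Definition ternary_partial b (N : nat) : R :=
  \sum_(k < N) if `[< b k >] then 3^-1 ^+ k else 0.

Definition ternary b : R := sup (range (ternary_partial b)).

Lemma ternary_partialS b N : ternary_partial b N.+1 =
  ternary_partial b N + if `[< b N >] then 3^-1 ^+ N else 0.
Proof. by rewrite /ternary_partial big_ord_recr. Qed.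

Lemma pow3V_gt0 k : 0 < 3^-1 ^+ k :> R.
Proof. by rewrite exprn_gt0// invr_gt0. Qed.

Lemma ternary_partial_nd b : {homo ternary_partial b : m n / (m <= n)%N >-> m <= n}.
Proof.
apply: homo_leq => [//|x y z|n]; first exact: le_trans.
by rewrite ternary_partialS; case: ifP => _; have := pow3V_gt0 n; lra.
Qed.

(* The right-hand side is decreasing in m: it adds the largest possible tail. *)
Lemma ternary_partial_ub b m n :
  ternary_partial b n <= ternary_partial b m + 3 / 2 * 3^-1 ^+ m.
Proof.
have step k : ternary_partial b k.+1 + 3 / 2 * 3^-1 ^+ k.+1 <=
    ternary_partial b k + 3 / 2 * 3^-1 ^+ k.
  by rewrite ternary_partialS exprS; case: ifP => _; have := pow3V_gt0 k; lra.
have [mn|/ltnW nm] := leqP m n.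
  have : ternary_partial b n + 3 / 2 * 3^-1 ^+ n <=
      ternary_partial b m + 3 / 2 * 3^-1 ^+ m.
    elim: n mn => [|n IH]; first by rewrite leqn0 => /eqP ->.
    rewrite leq_eqVlt => /orP[/eqP ->//|]; rewrite ltnS => /IH.
    exact: le_trans (step n).
  by have := pow3V_gt0 n; lra.
by have := ternary_partial_nd b nm; have := pow3V_gt0 m; lra.
Qed.

Lemma ternary_ge b n : ternary_partial b n <= ternary b.
Proof.
apply: ub_le_sup; last by exists n.
by exists (ternary_partial b 0 + 3 / 2 * 3^-1 ^+ 0) => _ [m _ <-];
  exact: ternary_partial_ub.
Qed.

Lemma ternary_le b n : ternary b <= ternary_partial b n + 3 / 2 * 3^-1 ^+ n.
Proof.
apply: ge_sup; first by exists (ternary_partial b 0), 0%N.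
by move=> _ [m _ <-]; exact: ternary_partial_ub.
Qed.

Lemma ternary_first_diff b c m : (forall k, (k < m)%N -> b k <-> c k) ->
  b m -> ~ c m -> 3^-1 ^+ m / 2 <= ternary b - ternary c.
Proof.
move=> bc bm ncm.
have eqm : ternary_partial b m = ternary_partial c m.
  apply: eq_bigr => k _; congr (if _ then _ else _).
  by apply/asboolP/asboolP => /(bc _ (ltn_ord k)).
(* Cutting at [m.+1] counts digit [m], worth [3^-m]; the tail of [c] is then at most
   [3/2 * 3^-(m+1) = 3^-m / 2]. *)
have := ternary_ge b m.+1; have := ternary_le c m.+1.
rewrite !ternary_partialS eqm exprS (asboolT bm) (asboolF ncm).
have := pow3V_gt0 m; lra.
Qed.

(** The first difference occurs at some [m <= n], where the gap is at least as large. As the bound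
    depends on [n] only, it yields both injectivity and the openness of the traces of the clopen
    sets. *)
Lemma ternary_diff b c n : b n -> ~ c n -> 3^-1 ^+ n / 2 <= `|ternary b - ternary c|.
Proof.
move=> bn ncn.
have ex : exists k, ~~ (`[< b k >] == `[< c k >]).
  by exists n; rewrite asboolT// asboolF.
case: (ex_minnP ex) => m bcm mmin.
have mn : (m <= n)%N by apply: mmin; rewrite asboolT// asboolF.
have eqk k : (k < m)%N -> b k <-> c k.
  move=> km; have : `[< b k >] = `[< c k >].
    by apply/eqP; apply: contraTT km => /mmin; rewrite -leqNgt.
  by move=> bck; split=> /asboolP; [rewrite bck|rewrite -bck] => /asboolP.
have pow : 3^-1 ^+ n <= 3^-1 ^+ m :> R.
  by apply: ler_wiXn2l => //; lra.
apply: (@le_trans _ _ (3^-1 ^+ m / 2)); first by lra.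
have [bm|nbm] := pselect (b m).
  have ncm : ~ c m by move=> cm; move: bcm; rewrite (asboolT bm) (asboolT cm).
  exact: le_trans (ternary_first_diff eqk bm ncm) (ler_norm _).
have cm : c m.
  by apply: contrapT => ncm; move: bcm; rewrite (asboolF nbm) (asboolF ncm).
rewrite distrC; apply: le_trans (ler_norm _).
by apply: ternary_first_diff => // k /eqk ->.
Qed.

End ternary.

(** * From an ultrafilter base to an unsplittable set of reals *)

Lemma not_split_of_ultrafilter_base (R : realType) (B : set (set nat)) :
  nonprincipal_ultrafilter_base B ->
  exists2 X : set R, ~ Split_Omega_Omega X & X #<= B.
Proof.
move=> [F [UF npF FE]].
pose e : set nat -> R := @ternary R.
pose X := e @` B; exists X; last exact: card_image_le.
have FB b : B b -> F b by move=> Bb; rewrite FE; exists b.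
pose u n := e @` [set b | B b /\ b n].
have eB n b c : B b -> c n -> e b = e c -> b n.
  move=> Bb cn ebc; apply: contrapT => nbn.
  have := @ternary_diff R _ _ _ cn nbn; rewrite -/(e c) -/(e b) ebc subrr normr0.
  by have := pow3V_gt0 R n; lra.
have uP n b : B b -> u n (e b) -> b n.
  by move=> Bb [c [Bc cn] /esym]; exact: eB.
(* The radius is the gap of [ternary_diff], so these open balls miss every [e b] with [n] outside
   [b]. *)
pose O n := \bigcup_(c in [set b | B b /\ b n]) ball (e c) (3^-1 ^+ n / 2)%R.
have uO n : u n = X `&` O n.
  apply/seteqP; split=> [_ [b [Bb bn] <-]|_ [[b Bb <-] [c [Bc cn] ebc]]].
    split; first by exists b.
    by exists b => //; apply: ballxx; have := pow3V_gt0 R n; lra.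
  exists b => //; split=> //; apply: contrapT => nbn.
  have := @ternary_diff R _ _ _ cn nbn; move: ebc; rewrite /ball /= -/(e c) -/(e b).
  by rewrite real_ltNge ?num_real// => /negP; exact.
pose U := range u.
(* The finitely many sets coded by [s] have their intersection in [F], hence a common element [n];
   then [u n] contains [s]. *)
have Ucov (s : set R) : finite_set s -> s `<=` X -> exists2 A, U A & s `<=` A.
  move=> /finite_seqP[l ->] lX.
  have : F [set n | forall x, x \in l -> u n x].
    elim: l lX => [|x l IH] lX; first by apply: filterS filterT.
    have [b Bb bx] : X x by apply: lX; rewrite /= mem_head.
    have Fl : F [set n | forall y, y \in l -> u n y].
      by apply: IH => y yl; apply: lX; rewrite /= inE yl orbT.
    apply: filterS (filterI (FB _ Bb) Fl) => n [bn ln] y.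
    by rewrite inE => /predU1P[->|/ln//]; exists b.
  by move=> /filter_ex[n nl]; exists (u n) => //; exists n.
have oU : omega_cover X U.
  split=> //.
    split.
    - exact: card_le_trans (card_image_le _ _) (card_lexx _).
    - have /choice[g gP] : forall A, exists O, U A -> open O /\ A = X `&` O.
        move=> A; have [[n _ <-]|nU] := pselect (U A); last by exists set0.
        exists (O n) => _; split=> //.
        by apply: bigcup_open => b _; exact: ball_open.
      by exists g => A /gP[].
    - apply/seteqP; split=> [x [_ [n _ <-]]|x Xx].
        by move=> [b [Bb _] <-]; exists b.
      have [|A UA xA] := Ucov [set x] (finite_set1 x); first by move=> _ ->.
      by exists A => //; exact: xA.
  (* If [u n] were all of [X], every [b] in [B] would contain [n], making [F] principal. *)
  move=> [n _ uX]; apply: (npF n); rewrite FE; apply/seteqP; split.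
    move=> A [b Bb bA]; apply/principal_filterP; apply: bA.
    by apply: (uP n b Bb); rewrite uX; exists b.
  have Bn b : B b -> b n by move=> Bb; apply: (uP n b Bb); rewrite uX; exists b.
  move=> A /principal_filterP An.
  have [FA|FnA] := in_ultra_setVsetC A UF; first by move: FA; rewrite {1}FE.
  by move: FnA; rewrite FE => -[b Bb /(_ _ (Bn _ Bb))].
move=> /(_ U oU)[V [W [VWU VW0 oV oW]]].
(* Stated for an arbitrary ordered pair of parts, since either [V] or [W] may be the one whose index
   set lies in [F]. *)
have noF V1 V2 : V1 `|` V2 = U -> V1 `&` V2 = set0 -> omega_cover X V2 ->
    ~ F [set n | V1 (u n)].
  move=> V12U V120 [_ _ V2fin]; rewrite FE => -[b Bb bV1].
  have [||A V2A bA] := V2fin [set e b]; first exact: finite_set1.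
    by move=> _ ->; exists b.
  have : U A by rewrite -V12U; right.
  move=> [n _ unA]; have bn : b n by apply: uP => //; rewrite unA; exact: bA.
  have V1A : V1 A by rewrite -unA; exact: bV1.
  by have : (V1 `&` V2) A by []; rewrite V120.
have [FV|FnV] := in_ultra_setVsetC [set n | V (u n)] UF.
  exact: noF VWU VW0 oW FV.
apply: (noF W V) => //; [by rewrite setUC|by rewrite setIC|].
apply: filterS FnV => n /= nV.
have [//|//] : (V `|` W) (u n) by rewrite VWU; exists n.
Qed.

Theorem mainTheorem9 (R : realType) :
  exists (X : set R) (B : set (set nat)),
    [/\ has_min_card (fun Y : set R => ~ Split_Omega_Omega Y) X,
        has_min_card nonprincipal_ultrafilter_base B
      & X #= B].
Proof.
have [B [Bbase Bmin]] :=
  min_card_exists exists_nonprincipal_ultrafilter_base.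
have [X nX XB] := not_split_of_ultrafilter_base R Bbase.
(* Minimality of [B] bounds every unsplittable [Y] from below; as [X] embeds into [B], it follows
   that [X] is minimal too. *)
have BY (Y : set R) : ~ Split_Omega_Omega Y -> B #<= Y.
  by move=> /ultrafilter_base_of_not_split[C /Bmin BC]; exact: card_le_trans.
exists X, B; split=> //.
- by split=> // Y /BY; exact: card_le_trans.
- by apply: Cantor_Bernstein => //; exact: BY.
Qed.
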